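(* Let $X$ and $Y$ be compact regular Hausdorff spaces that are split homeomorphic. Then $X$ and $Y$ are equivalent with cuts and subsequent re-glues.
   Context: Compact means that every open cover has a finite subcover (no separation axiom is included). A neighborhood of a point $p$ (respectively of a subset $S$) in a topological space is a set $V$, not necessarily open, for which there is an open set $U$ with $p \in U \subseteq V$ (respectively $S \subseteq U \subseteq V$). Let $f : X \to Y$ be a function between topological spaces and $p \in X$. The function $f$ is multi-split continuous at $p$ if there exists a finite non-empty set $Z_p \subseteq Y$ such that: (a) for every $y \in Z_p$ and all neighborhoods $U \subseteq X$ of $p$ and $V \subseteq Y$ of $y$ one has $f(U) \cap V \neq \varnothing$; (b) for every neighborhood $V \subseteq Y$ of the set $Z_p$ there exists a neighborhood $U \subseteq X$ of $p$ with $f(U) \subseteq V$. The function $f$ is globally multi-split continuous if it is multi-split continuous at every $p \in X$. A split homeomorphism is a bijection $f : X \to Y$ such that both $f$ and its inverse $f^{-1} : Y \to X$ are globally multi-split continuous. Two topological spaces $X$ and $Y$ are split homeomorphic if there exists a split homeomorphism $f : X \to Y$. Two compact regular Hausdorff spaces $X$ and $Y$ are equivalent with cuts and subsequent re-glues if there exist a compact space $Z$, two continuous finite-to-one surjections $p_X : Z \to X$ and $p_Y : Z \to Y$, and a (not necessarily continuous) right inverse $p_X^{-1} : X \to Z$ of $p_X$ (that is, $p_X \circ p_X^{-1} = \mathrm{id}_X$) such that $p_Y \circ p_X^{-1} : X \to Y$ is a bijection. A map is finite-to-one if every point of its codomain has a finite preimage. *)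

(* Defs.v *)
From HB Require Import structures.
From mathcomp Require Import all_boot all_classical.
From mathcomp Require Import topology.

Set Implicit Arguments.
Unset Strict Implicit.
Unset Printing Implicit Defensive.

Local Open Scope classical_set_scope.

(* [topologicalType] does not require a point, so empty spaces are included.
   [nbhs p] and [set_nbhs S] are the not necessarily open neighborhoods of a
   point and of a set; see [nbhsE] and [set_nbhsP]. *)

Definition multi_split_continuous_at (X Y : topologicalType) (f : X -> Y)
    (p : X) : Prop :=
  exists Zp : set Y,
    [/\ finite_set Zp,
        Zp !=set0,
        forall y, Zp y -> forall (U : set X) (V : set Y),
          nbhs p U -> nbhs y V -> (f @` U) `&` V !=set0 &
        forall V : set Y, set_nbhs Zp V ->
          exists2 U : set X, nbhs p U & f @` U `<=` V].

Definition globally_multi_split_continuous (X Y : topologicalType)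
    (f : X -> Y) : Prop :=
  forall p : X, multi_split_continuous_at f p.

Definition split_homeomorphism (X Y : topologicalType) (f : X -> Y) : Prop :=
  exists g : Y -> X,
    [/\ cancel f g, cancel g f,
        globally_multi_split_continuous f &
        globally_multi_split_continuous g].

Definition split_homeomorphic (X Y : topologicalType) : Prop :=
  exists f : X -> Y, split_homeomorphism f.

Definition finite_to_one (A B : Type) (f : A -> B) : Prop :=
  forall b : B, finite_set (f @^-1` [set b]).

(* [cover_compact] is the open-cover definition; it assumes no separation. *)
Definition cut_reglue_equivalent (X Y : topologicalType) : Prop :=
  exists (Z : topologicalType) (pX : Z -> X) (pY : Z -> Y) (sX : X -> Z),
    [/\ cover_compact [set: Z],
        [/\ continuous pX, finite_to_one pX & set_surj [set: Z] [set: X] pX],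
        [/\ continuous pY, finite_to_one pY & set_surj [set: Z] [set: Y] pY],
        cancel sX pX &
        bijective (pY \o sX)].

(* Main.v *)
Require Import Defs.
From HB Require Import structures.
From mathcomp Require Import all_boot finmap all_classical.
From mathcomp Require Import topology.

(** The witness for the cuts and re-glues is the closure Z of the graph of a
    split homeomorphism f inside X * Y, with its two projections and the
    section x |-> (x, f x); following the section by the second projection
    gives back f, a bijection.

    Compactness of Z is that of a closed subset of X * Y.  What has to be
    shown is that the projections have finite fibers.  A point (p, y) of Z
    says that f takes values arbitrarily close to y arbitrarily close to p.
    Let S be the finite set that witnesses multi-split continuity of f at p.
    Near p, the values of f stay inside any prescribed neighborhood of S; if y
    were outside S, which is closed, regularity would provide a neighborhood
    of S that misses a neighborhood of y, and no such values could exist.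
    Hence the fiber over p embeds in S ([closure_graph_sub]).  Exchanging the
    coordinates carries the graph of f to the graph of its inverse, and its
    closure to the closure ([closure_graph_swap]), so the fibers of the second
    projection are those of the first one for the inverse, which is
    multi-split continuous as well.

    Compactness is transported through products and closed subsets in its
    filter form; [compact_coverP] relates it to open covers on a space that
    may be empty. *)

Local Open Scope classical_set_scope.

(** [compact_cover] is about pointed spaces.  A space with a point can be made
    pointed; a subset of a space without points is compact in both senses. *)
Lemma compact_coverP (T : topologicalType) (A : set T) :
  compact A <-> cover_compact A.
Proof.
have [[t _]|T0] := pselect ([set: T] !=set0).
  pose pT := isPointed.Build T t.
  pose U : ptopologicalType := HB.pack (Topological.sort T) pT.
  by have := @compact_cover U; rewrite predeqE => /(_ A).
have noT (t : T) : False by apply: T0; exists t.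
split=> [_ I D g _ _|_ F FF FA].
  by exists fset0 => [i|t]; [rewrite in_fset0|case: (noT t)].
by have [t _] := filter_ex FA; case: (noT t).
Qed.

Lemma compact_set_type (T : topologicalType) (K : set T) :
  compact K -> compact [set: K].
Proof.
move=> cK F FF _.
have imK : (set_val @ F) K.
  by apply: (@filterE _ F) => z; exact: set_valP.
have [p [Kp clp]] := cK _ (fmap_proper_filter set_val FF) imK.
exists (SigSub (mem_set Kp)); split=> // A B FA [_ [[W oW <-] /= Wp] sWB].
have nW : nbhs p W by exact: open_nbhs_nbhs.
have FimA : (set_val @ F) (set_val @` A).
  by apply: (@filterS _ F _ A) => // z Az; exists z.
have [_ [[z Az <-] Wz]] := clp _ _ FimA nW.
by exists z; split=> //; exact: sWB.
Qed.

Definition graph {X Y : Type} (f : X -> Y) : set (X * Y) :=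
  [set xy | f xy.1 = xy.2].

(** A limit value y of f at p outside S would be separated from S by
    regularity, although f stays close to S near p.  Finiteness of S serves to
    make it closed. *)
Lemma closure_graph_sub (X Y : topologicalType) (f : X -> Y) (p : X)
    (S : set Y) :
  regular_space Y -> hausdorff_space Y -> finite_set S ->
  (forall V, set_nbhs S V -> exists2 U, nbhs p U & f @` U `<=` V) ->
  forall y, closure (graph f) (p, y) -> S y.
Proof.
move=> rY hY finS Snear y clpy; apply: contrapT => nSy.
have clS : closed S.
  by move/hausdorff_accessible/accessible_finite_set_closed: hY; apply.
have nS : nbhs y (~` S).
  by apply: open_nbhs_nbhs; split=> //; exact: closed_openC.
have [B nB clB] := rY y _ nS.
have nV : set_nbhs S (~` closure B).
  move=> z Sz; apply: open_nbhs_nbhs; split.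
    by apply: closed_openC; exact: closed_closure.
  by move=> /clB.
have [U nU fU] := Snear _ nV.
have nUB : nbhs (p, y) (U `*` B) by exists (U, B).
have [[x w] [/= fxw [/= Ux Bw]]] := clpy _ nUB.
by apply: (fU w); [exists x|exact: subset_closure].
Qed.

Lemma finite_closure_graph (X Y : topologicalType) (f : X -> Y) (p : X) :
  regular_space Y -> hausdorff_space Y -> multi_split_continuous_at f p ->
  finite_set [set y | closure (graph f) (p, y)].
Proof.
move=> rY hY [S [finS _ _ Snear]].
by apply: (sub_finite_set _ finS) => y; exact: closure_graph_sub.
Qed.

Lemma closure_graph_swap (X Y : topologicalType) (f : X -> Y) (g : Y -> X) :
  cancel f g -> forall x y,
  closure (graph f) (x, y) -> closure (graph g) (y, x).
Proof.
move=> fK x y clxy W nW.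
have [[a b] [/= fab Wba]] := clxy _ (@swap_continuous X Y (x, y) W nW).
by exists (b, a); split=> //=; rewrite /graph /= -[b]fab fK.
Qed.

Theorem proposition7p6 (X Y : topologicalType)
    (cX : cover_compact [set: X]) (rX : regular_space X)
    (hX : hausdorff_space X)
    (cY : cover_compact [set: Y]) (rY : regular_space Y)
    (hY : hausdorff_space Y)
    (XY : split_homeomorphic X Y) :
  cut_reglue_equivalent X Y.
Proof.
have [f [g [fK gK cf cg]]] := XY.
pose Z : set (X * Y) := closure (graph f).
have Zf x : (x, f x) \in Z by apply/mem_set/subset_closure.
pose s x : Z := SigSub (Zf x).
have valZ_cont : continuous (set_val : Z -> X * Y).
  exact: initial_continuous.
have valZ_inj : injective (set_val : Z -> X * Y) by exact: val_inj.
exists Z, (fst \o set_val), (snd \o set_val), s; split.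
- apply/compact_coverP/compact_set_type.
  apply: (@subclosed_compact _ _ ([set: X] `*` [set: Y])) => //.
    exact: closed_closure.
  by apply: compact_setX; exact/compact_coverP.
- split=> [z|p|x _].
  + by apply: continuous_comp; [exact: valZ_cont|exact: cvg_fst].
  + apply: (@sub_finite_set _ _
      (set_val @^-1` ([set p] `*` [set y | Z (p, y)]))).
      move=> z /= <-; split=> //=.
      by rewrite -surjective_pairing; exact: set_valP.
    apply: finite_preimage => [a b _ _|]; first exact: valZ_inj.
    by apply: finite_setX => //; exact: finite_closure_graph.
  + by exists (s x).
- split=> [z|q|y _].
  + by apply: continuous_comp; [exact: valZ_cont|exact: cvg_snd].
  + apply: (@sub_finite_set _ _
      (set_val @^-1` ([set x | closure (graph g) (q, x)] `*` [set q]))).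
      move=> z /= <-; split=> //=; apply: closure_graph_swap fK _ _ _.
      by rewrite -surjective_pairing; exact: set_valP.
    apply: finite_preimage => [a b _ _|]; first exact: valZ_inj.
    by apply: finite_setX => //; exact: finite_closure_graph.
  + by exists (s (g y)) => //=; exact: gK.
- by [].
- by exists g.
Qed.
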